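(* Let $A$ be an abelian group and let $X$ be a compact oriented triangulated $3$-manifold (without boundary). Suppose that every $3$-simplex of the triangulation is equipped with an angle structure with values in $A$, with corresponding elements denoted $k_{ab}^{cd}\in A$ for each positively oriented ordering $(a,b,c,d)$ of the vertices of a $3$-simplex, and suppose that with these angle structures $X$ is angled. Then in the group $\Lambda^2 A$ one has $$\sum_{abcd}\left(4\, k_{ab}^{cd}\wedge k_{ac}^{db}+k_{ad}^{bc}\wedge k_{ad}^{bc}+k_{bc}^{ad}\wedge k_{bc}^{ad}\right)=0,$$ where the sum is over the $3$-simplices $(a,b,c,d)$ which compose the fundamental class of $X$, i.e. over all $3$-simplices of the triangulation, each taken once with its vertices written in an order $(a,b,c,d)$ compatible with the orientation of $X$.
   Context: The group $A$ is written additively. The triangulation is simplicial, so simplices are denoted by their vertices. $\Lambda^2 A$ denotes the quotient of $A\otimes_{\mathbb Z}A$ by the subgroup generated by all elements $x\otimes y+y\otimes x$ with $x,y\in A$; the image of $x\otimes y$ is written $x\wedge y$. Thus $x\wedge y=-y\wedge x$ and $2\,(x\wedge x)=0$, but $x\wedge x$ is not required to vanish. Angle structure: let $\Delta=(a,b,c,d)$ be an oriented $3$-simplex. An angle structure on $\Delta$ (with values in $A$) is a collection of $12$ elements $k_{xy}\in A$, one for each oriented edge $xy$ of $\Delta$ (ordered pair of distinct vertices), satisfying $k_{xy}=k_{yx}$ for every edge, and $\sum_{y} k_{xy}=0$ for every vertex $x$ of $\Delta$ (sum over the three other vertices $y$ of $\Delta$). Notation $k_{ab}^{cd}$: when every $3$-simplex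 of $X$ carries an angle structure, for a $3$-simplex with vertices $a,b,c,d$ such that the ordering $(a,b,c,d)$ is compatible with the orientation of $X$, $k_{ab}^{cd}$ denotes the element $k_{ab}$ of the angle structure on that simplex. Thus the $12$ elements attached to the simplex $(a,b,c,d)$ are $$k_{ab}^{cd}=k_{ba}^{dc},\quad k_{ac}^{db}=k_{ca}^{bd},\quad k_{ad}^{bc}=k_{da}^{cb},\quad k_{bc}^{ad}=k_{cb}^{da},\quad k_{bd}^{ca}=k_{db}^{ac},\quad k_{cd}^{ab}=k_{dc}^{ba},$$ and the notation is invariant with respect to even permutations of the vertices of the simplex. Angled: for each edge $ab$ of $X$ let $(a,b,x_i,x_{i+1})$, $i=0,1,\ldots,n-1$, with $x_n=x_0$, be the $3$-simplices adjacent to $ab$, listed in cyclic order around $ab$ with vertex orderings compatible with the orientation of $X$. The manifold $X$ with the given angle structures is called angled if for every edge $ab$ $$\sum_{i=0}^{n-1} k_{ab}^{x_i x_{i+1}}=0.$$ *)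

(* Defs.v *)
From HB Require Import structures.
From mathcomp Require Import all_boot all_order all_algebra.
From mathcomp Require Import generic_quotient.
From mathcomp Require Import all_classical all_reals all_analysis.
From mathcomp.multinomials Require freeg.

Set Implicit Arguments.
Unset Strict Implicit.
Unset Printing Implicit Defensive.

Import Order.TTheory GRing.Theory Num.Theory.
Import numFieldNormedType.Exports.

Local Open Scope classical_set_scope.
Local Open Scope ring_scope.

Section QuotientGroup.
Context (G : zmodType).

Definition is_subgroup (S : set G) : Prop :=
  S 0 /\ forall x y, S x -> S y -> S (x - y).

Definition generated_subgroup (P : set G) : set G := smallest is_subgroup P.

Lemma generated_subgroupP (P : set G) : is_subgroup (generated_subgroup P).
Proof.
split=> [S [[S0 _] _] // | x y Px Py S SP].
by case: (SP) => [[_ SB] _]; apply: SB; [apply: Px | apply: Py].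
Qed.

Definition in_generated (P : set G) : {pred G} :=
  fun x => `[< generated_subgroup P x >].

Fact in_generated_zmod_closed (P : set G) : zmod_closed (in_generated P).
Proof.
have [h0 hB] := generated_subgroupP P.
by split=> [|x y /asboolP hx /asboolP hy]; apply/asboolP; [|apply: hB].
Qed.

HB.instance Definition _ (P : set G) :=
  GRing.isZmodClosed.Build G (in_generated P) (in_generated_zmod_closed P).

Definition quotient_by (P : set G) : zmodType :=
  Quotient.quot (in_generated P).

Definition quotient_class (P : set G) (x : G) : quotient_by P :=
  (\pi_(Quotient.quot (in_generated P)) x)%qT.

Lemma quotient_classB (P : set G) : {morph @quotient_class P : x y / x - y}.
Proof. by move=> x y; rewrite /quotient_class !piE. Qed.

Lemma quotient_classD (P : set G) : {morph @quotient_class P : x y / x + y}.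
Proof. by move=> x y; rewrite /quotient_class !piE. Qed.

Lemma quotient_class_eq0 (P : set G) (x : G) :
  quotient_class P x = 0 <-> generated_subgroup P x.
Proof.
rewrite -[0 in X in X <-> _](subrr (quotient_class P 0)) -quotient_classB subrr.
split=> [/eqP|h].
  by rewrite /quotient_class -Quotient.idealrBE subr0 => /asboolP.
by apply/eqP; rewrite /quotient_class -Quotient.idealrBE subr0; apply/asboolP.
Qed.

End QuotientGroup.

Section ExteriorSquare.
Import freeg.
Context (A : zmodType).

Definition tensor_gen (x y : A) : {freeg (A * A) / int} :=
  Freeg [:: (1, (x, y))].

Local Notation gen := tensor_gen.

Definition tensor_relations : set {freeg (A * A) / int} :=
  [set r | exists x y z, r = gen (x + y) z - gen x z - gen y z
                      \/ r = gen x (y + z) - gen x y - gen x z].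

Definition tensor_square : zmodType := quotient_by tensor_relations.

Definition tensor (x y : A) : tensor_square :=
  quotient_class tensor_relations (gen x y).

Definition wedge_relations : set tensor_square :=
  [set r | exists x y, r = tensor x y + tensor y x].

Definition ext_square : zmodType := quotient_by wedge_relations.

Definition wedge (x y : A) : ext_square :=
  quotient_class wedge_relations (tensor x y).

Lemma tensorDl (x y z : A) : tensor (x + y) z = tensor x z + tensor y z.
Proof.
apply/eqP; rewrite -subr_eq0 opprD addrA /tensor -!quotient_classB; apply/eqP.
by apply/quotient_class_eq0 => S [_]; apply; exists x, y, z; left.
Qed.

Lemma tensorDr (x y z : A) : tensor x (y + z) = tensor x y + tensor x z.
Proof.
apply/eqP; rewrite -subr_eq0 opprD addrA /tensor -!quotient_classB; apply/eqP.
by apply/quotient_class_eq0 => S [_]; apply; exists x, y, z; right.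
Qed.

Lemma wedgeDl (x y z : A) : wedge (x + y) z = wedge x z + wedge y z.
Proof. by rewrite /wedge tensorDl quotient_classD. Qed.

Lemma wedgeDr (x y z : A) : wedge x (y + z) = wedge x y + wedge x z.
Proof. by rewrite /wedge tensorDr quotient_classD. Qed.

Lemma wedgeC (x y : A) : wedge x y = - wedge y x.
Proof.
apply/eqP; rewrite -subr_eq0 opprK /wedge -quotient_classD; apply/eqP.
by apply/quotient_class_eq0 => S [_]; apply; exists x, y.
Qed.

End ExteriorSquare.

Section Realization.
Context (R : realType) (V : finType).

Definition barycentric (x : 'rV[R]_#|V|) (v : V) : R := x ord0 (enum_rank v).

Definition realization (K : {set {set V}}) : set 'rV[R]_#|V| :=
  [set x | [/\ forall v, 0 <= barycentric x v,
               \sum_(v : V) barycentric x v = 1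
             & [set v | barycentric x v != 0]%SET \in K]].

End Realization.

Definition homeomorphic (S T : topologicalType) (X : set S) (Y : set T) : Prop :=
  exists (f : S -> T) (g : T -> S),
    [/\ {within X, continuous f}, {within Y, continuous g},
        forall x, X x -> Y (f x) /\ g (f x) = x
      & forall y, Y y -> X (g y) /\ f (g y) = y].

(* Charts onto open subsets of R^n, so that there is no boundary; Hausdorffness
   and second countability are inherited from the ambient space. *)
Definition topological_manifold (R : realType) (n N : nat) (X : set 'rV[R]_N) :
    Prop :=
  forall x, X x -> exists (U : set 'rV[R]_N) (O : set 'rV[R]_n),
    [/\ open U, U x, open O & homeomorphic (X `&` U) O].

Section Triangulation.
Context (V : finType).
Implicit Types (K : {set {set V}}) (a b c d e : V).

Definition simplicial_complex K : Prop :=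
  finset.set0 \notin K /\
  forall s s' : {set V}, s \in K -> s' \subset s -> s' != finset.set0 -> s' \in K.

Definition simplices K (n : nat) : {set {set V}} :=
  [set s in K | #|s| == n.+1]%SET.

Definition pure_of_dim K (n : nat) : Prop :=
  forall s, s \in K -> exists2 t, t \in simplices K n & s \subset t.

(* Compactness is the finiteness of K. *)
Definition closed_triangulated_3manifold (R : realType) K : Prop :=
  [/\ simplicial_complex K, pure_of_dim K 3
    & topological_manifold 3 (@realization R V K)].

Definition vset a b c d : {set V} := [set a; b; c; d]%SET.

(* [pos a b c d] means that a, b, c, d are the vertices of a 3-simplex, listed
   in an order compatible with the orientation. By the last clause, two distinct
   3-simplices with a common face b, c, d induce opposite orientations on it. *)
Record orientation K (pos : V -> V -> V -> V -> bool) : Prop := Orientation {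
  pos_simplex : forall a b c d, pos a b c d -> vset a b c d \in simplices K 3;
  pos_swap12 : forall a b c d, vset a b c d \in simplices K 3 ->
    pos b a c d = ~~ pos a b c d;
  pos_swap23 : forall a b c d, vset a b c d \in simplices K 3 ->
    pos a c b d = ~~ pos a b c d;
  pos_swap34 : forall a b c d, vset a b c d \in simplices K 3 ->
    pos a b d c = ~~ pos a b c d;
  pos_coherent : forall a e b c d, pos a b c d -> pos e b c d -> e = a }.

Definition angle_structure (A : zmodType) (t : {set V}) (k : V -> V -> A) :
    Prop :=
  (forall x y, x \in t -> y \in t -> x != y -> k x y = k y x) /\
  (forall x, x \in t -> \sum_(y in t | y != x) k x y = 0).

(* The element $k_{ab}^{cd}$, where [k t] is the angle structure on t. *)
Definition angle (A : zmodType) (k : {set V} -> V -> V -> A) a b c d : A :=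
  k (vset a b c d) a b.

(* s = [:: x_0; ...; x_{n-1}] lists in cyclic order the 3-simplices
   (a, b, x_i, x_{i+1}) adjacent to ab. *)
Definition cyclic_star (pos : V -> V -> V -> V -> bool) a b (s : seq V) : Prop :=
  uniq s /\ forall c d, pos a b c d = (c \in s) && (d == next s c).

(* In a 3-manifold the list s exists and is unique up to rotation. *)
Definition angled K (pos : V -> V -> V -> V -> bool) (A : zmodType)
    (k : {set V} -> V -> V -> A) : Prop :=
  forall a b, a != b -> [set a; b]%SET \in K ->
    exists2 s, cyclic_star pos a b s
             & \sum_(c <- s) angle k a b c (next s c) = 0.

End Triangulation.

(* Main.v *)
Require Import Defs.
From HB Require Import structures.
From mathcomp Require Import all_boot all_order all_algebra.
From mathcomp Require Import all_classical all_reals all_analysis.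
From mathcomp Require Import ssrAC lra ring.

(** The sum vanishes because the angles have potentials, and in terms of the
    potentials the summand of a tetrahedron is the boundary of a function of
    its faces.

    The potentials are elements f_a(bc) of A, one for each corner a of each
    face abc, symmetric in b and c, such that
      k_ab^cd = f_a(bd) - f_a(bc)
    for every positively oriented tetrahedron abcd ([corner_potential]). Put
      omega(x, y, z) = x /\ y + y /\ z + z /\ x
    and attach omega(f_a(bc), f_b(ca), f_c(ab)) to the oriented face abc. This
    element changes sign with the orientation of the face. The relations
    k_ab^cd = k_ba^dc and the vanishing of the angle sums at the four vertices
    give enough relations between the twelve potentials of a tetrahedron to
    identify its summand with the sum of the elements attached to its four
    oriented faces ([wedge_tetrahedron], [tetrahedron_faces]). Every face lies
    in exactly two tetrahedra, which induce opposite orientations on it, so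
    everything cancels ([sum_opposite_cancel]).

    To construct f_a, look at the link of the vertex a. The element k_ab^cd
    sits at the corner b of the triangle bcd of the link. Since the elements
    around the vertex b of the link add up to 0, they are the increments of a
    function r_ab on the neighbours of b ([edge_potential]). Since the elements
    in each triangle add up to 0, the differences r_ab(c) - r_ac(b) form a
    1-cocycle on the link ([link_triangle_cocycle]). If this cocycle is the
    coboundary of m, then f_a(bc) = r_ab(c) + m(b) is symmetric in b and c.

    So the topology of X enters through one fact, that the first cohomology of
    the link of a vertex with coefficients in A is zero
    ([link_cocycle_exact]). It comes from R^3 minus a point as follows. A chart
    at the vertex a carries the open stars of the vertices b of the link to
    sets W_b which cover a punctured neighbourhood of a point of R^3. A cocycle
    D on the link is then a system of transition functions for this cover, and
    one looks for a branch: elements phi(y, b), for y in W_b, locally constant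
    in y, with phi(y, c) - phi(y, b) = D(b, c). Branches exist locally, and two
    of them over closed pieces with connected intersection can be glued after
    adding a constant ([splits_glue]). Bisection yields branches over convex
    sets ([splits_convex]). A cubical shell around the point is a union of six
    convex slab_union, which can be added one after the other with connected
    intersections ([splits_shell]); this is where dimension at least 3 is
    used. Finally a small copy of the link lies in the shell, and the values of
    a branch at its vertices form a primitive of D ([chart_link_exact]). *)

Set Implicit Arguments.
Unset Strict Implicit.
Unset Printing Implicit Defensive.

Import Order.TTheory GRing.Theory Num.Theory.
Import numFieldNormedType.Exports.
Local Open Scope ring_scope.

(** * The cyclic wedge of three elements *)

Section CyclicWedge.
Context (A : zmodType).
Implicit Types x y z u v w : A.

Lemma wedge0l x : wedge 0 x = 0.
Proof. by apply: (addrI (wedge 0 x)); rewrite -wedgeDl !addr0. Qed.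

Lemma wedge0r x : wedge x 0 = 0.
Proof. by rewrite wedgeC wedge0l oppr0. Qed.

Lemma wedgeNl x y : wedge (- x) y = - wedge x y.
Proof. by apply: (addrI (wedge x y)); rewrite -wedgeDl !subrr wedge0l. Qed.

Lemma wedgeNr x y : wedge x (- y) = - wedge x y.
Proof. by rewrite wedgeC wedgeNl -wedgeC. Qed.

Lemma wedge_selfN x : - wedge x x = wedge x x.
Proof. by rewrite -wedgeC. Qed.

Lemma wedge_selfD x y : wedge (x + y) (x + y) = wedge x x + wedge y y.
Proof.
by rewrite wedgeDl !wedgeDr [wedge y x]wedgeC addrA addrK.
Qed.

Lemma wedge_self2 x : wedge x x *+ 2 = 0.
Proof. by rewrite mulr2n -{1}wedge_selfN addNr. Qed.

Lemma wedgeMnl x y n : wedge (x *+ n) y = wedge x y *+ n.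
Proof.
by elim: n => [|n IH]; rewrite ?mulr0n ?wedge0l// !mulrS wedgeDl IH.
Qed.

(** The oriented area of the triangle xyz: this is (y - x) /\ (z - x) up to the
    term x /\ x, which is killed by 2. *)
Definition cyclic_wedge x y z : ext_square A :=
  wedge x y + wedge y z + wedge z x.

Lemma cyclic_wedge_rot x y z : cyclic_wedge y z x = cyclic_wedge x y z.
Proof. by rewrite /cyclic_wedge addrC addrA. Qed.

Lemma cyclic_wedge_swap x y z : cyclic_wedge y x z = - cyclic_wedge x y z.
Proof.
rewrite /cyclic_wedge !opprD -!wedgeC; exact: (AC 3 (1*3*2)).
Qed.

Lemma cyclic_wedgeD x y z u v w :
  cyclic_wedge (x + u) (y + v) (z + w) =
  cyclic_wedge x y z
  + (wedge (w - v) x + wedge (u - w) y + wedge (v - u) z)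
  + cyclic_wedge u v w.
Proof.
rewrite /cyclic_wedge !(wedgeDl, wedgeDr) !wedgeNl.
rewrite -(wedgeC x v) -(wedgeC y w) -(wedgeC z u) !addrA.
exact: (ACl (1*5*9*11*2*3*6*7*10*4*8*12)).
Qed.

(** The four triangles are the boundary of the tetrahedron xyzt, so each of its
    six edges occurs once in each direction. *)
Lemma cyclic_wedge_boundary x y z t :
  cyclic_wedge y z t + cyclic_wedge x t z + cyclic_wedge t x y
  + cyclic_wedge z y x = 0.
Proof.
rewrite /cyclic_wedge (wedgeC t z) (wedgeC t x) (wedgeC y t) (wedgeC z y).
rewrite (wedgeC y x) (wedgeC x z) !addrA.
rewrite (ACl ((1*10)*(2*5)*(3*9)*(4*7)*(6*12)*(8*11))) /=.
by rewrite !subrr !addr0.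
Qed.

(** The identity behind the theorem. For a tetrahedron with vertices v_1, ...,
    v_4, the elements a, b, c, d are the potentials of the corners of v_1,
    ..., v_4 in the faces opposite to v_4, v_4, v_4, v_3 respectively; x, y and
    s are the angles at the edges v_1v_2, v_1v_3 and v_2v_3. All twelve
    potentials are then determined. The identity has no term in a, b, c, d
    because adding a constant to all potentials at one vertex changes neither
    side. The hypothesis is what remains of the four angle sums: opposite
    angles may differ by an element of order 2. *)
Lemma wedge_tetrahedron a b c d x y s : s + s = - (x + y) - (x + y) ->
  wedge x y *+ 4 + wedge (x + y) (x + y) + wedge s s =
  cyclic_wedge (b + s) (c - s) (d - (x + s))
  + cyclic_wedge (a - y) (d + (x + y)) (c + y)
  + cyclic_wedge d (a + x) (b - x) + cyclic_wedge c b a.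
Proof.
move=> ss.
(* Each of the first three terms is split into its value at (a, b, c, d), its
   part linear in these elements and its value at (x, y, s). *)
have ss0 : s + s + (x + y + (x + y)) = 0 by rewrite ss -opprD addNr.
have -> : cyclic_wedge (b + s) (c - s) (d - (x + s)) = cyclic_wedge b c d
    + (wedge (- x) b + wedge (x + s + s) c + wedge (- s - s) d)
    + (wedge s x *+ 2 + wedge s s).
  rewrite cyclic_wedgeD; congr (_ + _ + _).
    rewrite !opprK; congr (wedge _ b + wedge _ c + _); last by rewrite addrC.
    by rewrite opprD subrK.
  rewrite /cyclic_wedge !(wedgeNl, wedgeNr, wedgeDl, wedgeDr) !opprK.
  rewrite opprD -(wedgeC s x) mulr2n.
  by rewrite (AC (1*2*2) ((2*4)*(1*3)*5)) /= addNr addr0 wedge_selfN.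
have -> : cyclic_wedge (a - y) (d + (x + y)) (c + y) = cyclic_wedge a d c
    + (wedge (- x) a + wedge (- y - y) d + wedge (x + y + y) c)
    + (wedge x y *+ 2 + wedge y y).
  rewrite cyclic_wedgeD; congr (_ + _ + _).
    by congr (wedge _ a + wedge _ d + _); rewrite ?opprK ?opprD// addrC subrK.
  rewrite /cyclic_wedge !(wedgeNl, wedgeNr, wedgeDl, wedgeDr).
  rewrite opprD -(wedgeC x y) mulr2n.
  by rewrite (AC (2*2*1) ((1*3)*(4*2)*5)) /= subrr addr0 wedge_selfN.
have -> : cyclic_wedge d (a + x) (b - x) = cyclic_wedge d a b
    + (wedge (- x - x) d + wedge x a + wedge x b) + wedge x x.
  rewrite -[in LHS](addr0 d) cyclic_wedgeD !subr0 sub0r opprK.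
  by rewrite /cyclic_wedge wedge0l wedge0r add0r addr0 wedgeNr wedge_selfN.
set B1 := cyclic_wedge b c d; set B2 := cyclic_wedge a d c.
set B3 := cyclic_wedge d a b; set B4 := cyclic_wedge c b a.
set C1 := wedge s x *+ 2 + _; set C2 := wedge x y *+ 2 + _.
have base : B1 + B2 + B3 + B4 = 0 by exact: cyclic_wedge_boundary.
have lin : (wedge (- x) b + wedge (x + s + s) c + wedge (- s - s) d)
  + (wedge (- x) a + wedge (- y - y) d + wedge (x + y + y) c)
  + (wedge (- x - x) d + wedge x a + wedge x b) = 0.
  rewrite !addrA (ACl ((1*9)*(4*8)*(2*6)*(3*5*7))) /= -!wedgeDl.
  rewrite !addNr !wedge0l !add0r -!opprD.
  rewrite [X in wedge X c](AC (3*3) ((2*3)*((1*5)*(4*6)))) /=.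
  rewrite [X in wedge (- X) d](AC (2*2*2) ((1*2)*((5*3)*(6*4)))) /=.
  by rewrite ss0 oppr0 !wedge0l addr0.
rewrite [RHS](AC (3*3*3*1) ((1*4*7*10)*(2*5*8)*(3*6*9))) /= base lin !add0r.
have -> : C1 = wedge x y *+ 2 + wedge s s.
  rewrite /C1 -wedgeMnl mulr2n ss -opprD wedgeNl -mulr2n wedgeMnl wedgeDl.
  by rewrite mulrnDl wedge_self2 add0r -mulNrn -wedgeC.
rewrite /C2 wedge_selfD (mulrnDr _ 2 2).
exact: (AC (2*2*1) ((1*5)*(2*4)*3)).
Qed.

End CyclicWedge.

(** * Multivalued functions and their branches *)

Local Open Scope classical_set_scope.

Section LocallyConstant.
Context (T : topologicalType) (B : Type).

Definition locally_constant (S : set T) (h : T -> B) : Prop :=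
  forall x, S x -> \forall y \near x, S y -> h y = h x.

Lemma connected_locally_constant (S : set T) (h : T -> B) :
  connected S -> locally_constant S h ->
  forall x y, S x -> S y -> h x = h y.
Proof.
move=> Scon hS x y Sx Sy.
suff E : S `&` [set z | h z = h x] = S.
  by have [] : (S `&` [set z | h z = h x]) y by rewrite E.
apply: Scon; first by exists x.
- exists (interior [set z | S z -> h z = h x]); first exact: open_interior.
  apply/seteqP; split => z [Sz hz]; split=> //.
    by rewrite /interior /=; apply: filterS (hS z Sz) => w hw /hw ->.
  exact: (interior_subset hz).
- exists (~` interior [set z | S z -> h z <> h x]).
    by rewrite closedC; exact: open_interior.
  apply/seteqP; split => z [Sz hz]; split=> //.
    by move=> /interior_subset /(_ Sz).
  apply: contrapT => hzx; apply: hz; rewrite /interior /=.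
  by apply: filterS (hS z Sz) => w hw /hw ->.
Qed.

End LocallyConstant.

Section Branches.
Context (T : topologicalType) (V : Type) (A : zmodType).
Variables (W : V -> set T) (D : V -> V -> A).
Implicit Types (S P C : set T).

(** D is read as the transition functions of a principal bundle with discrete
    group A, trivialised over each W b; a branch is a section of it over S. The
    value phi x b is meaningful only for x in W b. *)
Record branch S (phi : T -> V -> A) : Prop := Branch {
  branch_jump : forall x b c, S x -> W b x -> W c x ->
    phi x c - phi x b = D b c;
  branch_cst : forall b, locally_constant (S `&` W b) (phi ^~ b) }.

Definition splits S : Prop := exists phi, branch S phi.

(** Openness is relative to S, since the sets W b come from a chart and are
    open only in its domain. *)
Record cocycle_cover S : Prop := CocycleCover {
  cover_open : forall b x, S x -> W b x -> \forall y \near x, S y -> W b y;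
  cover_total : forall x, S x -> exists b, W b x;
  cover_cocycle : forall x b c d, S x -> W b x -> W c x -> W d x ->
    D b c + D c d = D b d }.

Lemma splits_sub S P : P `<=` S -> splits S -> splits P.
Proof.
move=> PS [phi [jump cst]]; exists phi; split=> [x b c /PS|b x [/PS Sx Wx]].
  exact: jump.
have := cst b x (conj Sx Wx).
by apply: filterS => y h [/PS Sy Wy]; apply: h.
Qed.

Lemma splits_chart S b : cocycle_cover S -> splits (S `&` W b).
Proof.
move=> [_ _ coc]; exists (fun _ => D b); split=> [x c d [Sx bx] cx dx|c x _].
  by rewrite -(coc x b c d) // addrC addKr.
exact: nearW.
Qed.

(** On the intersection the two branches differ by an element of A which does
    not depend on b, because they have the same jumps, and which is locally
    constant. By connectedness it is constant, and it can be added to the second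
    branch. *)
Lemma splits_glue S C1 C2 : cocycle_cover S -> closed C1 -> closed C2 ->
  splits (S `&` C1) -> splits (S `&` C2) -> connected (S `&` (C1 `&` C2)) ->
  splits (S `&` (C1 `|` C2)).
Proof.
move=> [Wop Wcov _] C1cl C2cl [f [fj fc]] [g [gj gc]] Icon.
set I := S `&` (C1 `&` C2) in Icon.
have diff x b c : I x -> W b x -> W c x -> f x b - g x b = f x c - g x c.
  move=> [Sx [x1 x2]] bx cx.
  have -> : f x b = f x c - D b c by rewrite -(fj x b c)// opprB addrC subrK.
  have -> : g x b = g x c - D b c by rewrite -(gj x b c)// opprB addrC subrK.
  by rewrite opprB addrA subrK.
(* If the intersection is empty, any constant will do. *)
have [k Hk] : exists k, forall x b, I x -> W b x -> f x b = g x b + k.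
  have [[x0 Ix0]|I0] := pselect (I !=set0); last first.
    by exists 0 => x b Ix; case: I0; exists x.
  have [b0 bx0] := Wcov x0 Ix0.1.
  (* A choice of an index at each point makes the difference a function of the
     point alone. *)
  have [w Hw] : exists w : T -> V, forall x, I x -> W (w x) x.
    have : forall x, exists b, I x -> W b x.
      move=> x; have [Ix|nIx] := pselect (I x); last by exists b0.
      by have [b bx] := Wcov x Ix.1; exists b.
    by move=> /choice[w Hw]; exists w.
  exists (f x0 b0 - g x0 b0) => x b Ix bx.
  suff <- : f x b - g x b = f x0 b0 - g x0 b0 by rewrite addrC subrK.
  rewrite (diff x b (w x)) ?(diff x0 b0 (w x0))//; try exact: Hw.
  apply: (connected_locally_constant (S := I)
    (h := fun x => f x (w x) - g x (w x))) => //.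
  move=> y Iy; have Wy := Hw y Iy; case: (Iy) => Sy [y1 y2].
  near=> z => Iz; case: (Iz) => Sz [z1 z2].
  have Wz : W (w y) z by move: Sz; near: z; exact: Wop.
  rewrite (diff z (w z) (w y))//; last exact: Hw.
  congr (_ - _).
    have : (S `&` C1 `&` W (w y)) z by [].
    by near: z; apply: fc.
  have : (S `&` C2 `&` W (w y)) z by [].
  by near: z; apply: gc.
pose h x b := if `[< C1 x >] then f x b else g x b + k.
have h1 x b : C1 x -> h x b = f x b by rewrite /h => /asboolT ->.
have h2 x b : S x -> C2 x -> W b x -> h x b = g x b + k.
  by move=> Sx x2 bx; rewrite /h; case: asboolP => // x1; rewrite Hk.
exists h; split=> [x b c [Sx [x1|x2]] bx cx|b x [[Sx x12] bx]].
- by rewrite !h1// fj.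
- by rewrite !h2// opprD addrACA subrr addr0 gj.
have near1 : \forall y \near x, (S `&` C1 `&` W b) y -> C1 x /\ f y b = f x b.
  have [x1|x1] := pselect (C1 x).
    have := fc b x (conj (conj Sx x1) bx).
    by apply: filterS => y H /H.
  have : nbhs x (~` C1) by apply: open_nbhs_nbhs; split=> //; rewrite openC.
  by apply: filterS => y y1 [[]].
have near2 : \forall y \near x, (S `&` C2 `&` W b) y -> C2 x /\ g y b = g x b.
  have [x2|x2] := pselect (C2 x).
    have := gc b x (conj (conj Sx x2) bx).
    by apply: filterS => y H /H.
  have : nbhs x (~` C2) by apply: open_nbhs_nbhs; split=> //; rewrite openC.
  by apply: filterS => y y2 [[]].
near=> y => -[[Sy [y1|y2]] wy].
- have [x1 E] : C1 x /\ f y b = f x b.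
    have : (S `&` C1 `&` W b) y by [].
    by near: y; exact: near1.
  by rewrite !h1.
- have [x2 E] : C2 x /\ g y b = g x b.
    have : (S `&` C2 `&` W b) y by [].
    by near: y; exact: near2.
  by rewrite !h2// E.
Unshelve. all: by end_near.
Qed.

End Branches.

(** * Branches over convex subsets of Euclidean space *)

Section Convex.
Context (R : realType) (n : nat).
Local Notation E := 'rV[R]_n.
Implicit Types (S P Q : set E) (x y p : E) (i : 'I_n).

Definition convex S : Prop := forall x y (t : R),
  S x -> S y -> 0 <= t <= 1 -> S (x + t *: (y - x)).

Lemma convexI P Q : convex P -> convex Q -> convex (P `&` Q).
Proof.
by move=> cP cQ x y t [Px Qx] [Py Qy] t01; split; [exact: cP|exact: cQ].
Qed.

Lemma segmentE x y (t : R) i :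
  (x + t *: (y - x)) ord0 i = x ord0 i + t * (y ord0 i - x ord0 i).
Proof. by rewrite !mxE. Qed.

Lemma convex_coord_le i a : convex [set x : E | x ord0 i <= a].
Proof. by move=> x y t /= xa ya /andP[t0 t1]; rewrite segmentE; nra. Qed.

Lemma convex_coord_ge i a : convex [set x : E | a <= x ord0 i].
Proof. by move=> x y t /= xa ya /andP[t0 t1]; rewrite segmentE; nra. Qed.

Lemma closed_coord_le i a : closed [set x : E | x ord0 i <= a].
Proof.
rewrite (_ : [set _ | _] = (fun x : E => x ord0 i) @^-1` [set t | t <= a])//.
by apply: closed_comp => [x _|]; [exact: coord_continuous|exact: closed_le].
Qed.

Lemma closed_coord_ge i a : closed [set x : E | a <= x ord0 i].
Proof.
rewrite (_ : [set _ | _] = (fun x : E => x ord0 i) @^-1` [set t | a <= t])//.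
by apply: closed_comp => [x _|]; [exact: coord_continuous|exact: closed_ge].
Qed.

Lemma convex_connected S : convex S -> connected S.
Proof.
move=> cS; have [[x Sx]|S0] := pselect (S !=set0); last first.
  suff -> : S = set0 by exact: connected0.
  by apply/seteqP; split => // x Sx; case: S0; exists x.
pose seg y := (fun t : R => x + t *: (y - x)) @` `[0, 1].
have -> : S = \bigcup_(y in S) seg y.
  apply/seteqP; split => [y Sy|z [y Sy [t /= t01 <-]]].
    exists y => //; exists 1; first by rewrite /= in_itv /= ler01 lexx.
    by rewrite scale1r addrC subrK.
  by apply: cS => //; move: t01; rewrite in_itv.
apply: bigcup_connected.
  exists x => y Sy; exists 0; first by rewrite /= in_itv /= ler01 lexx.
  by rewrite scale0r addr0.
move=> y Sy; apply: connected_continuous_connected.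
  exact: segment_connected.
apply: continuous_subspaceT => t.
apply: cvgD; first exact: cvg_cst.
exact: cvgZr_tmp.
Qed.

End Convex.

Section Subdivision.
Context (R : realType) (n : nat) (V : Type) (A : zmodType).
Local Notation E := 'rV[R]_n.
Variables (W : V -> set E) (D : V -> V -> A) (S : set E).
Hypothesis S_cover : cocycle_cover W D S.

Definition narrow (i : 'I_n) (w : R) (P : set E) : Prop :=
  exists a, forall y, P y -> a <= y ord0 i <= a + w.

Lemma narrow_sub i w (P Q : set E) : Q `<=` P -> narrow i w P -> narrow i w Q.
Proof. by move=> QP [a Ha]; exists a => y /QP; exact: Ha. Qed.

Lemma cocycle_cover_sub P : P `<=` S -> cocycle_cover W D P.
Proof.
case: S_cover => op tot coc PS; split.
- move=> b x /PS Sx bx; apply: filterS (op b x Sx bx) => y h /PS.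
  exact: h.
- by move=> x /PS; exact: tot.
- by move=> x b c d /PS; exact: coc.
Qed.

(** Both halves of a convex set cut by a coordinate hyperplane are convex, and
    so is their intersection, which is therefore connected. *)
Lemma splits_halving i (w : R) m (P : set E) :
  P `<=` S -> convex P -> narrow i (2 ^+ m * w) P ->
  (forall Q, Q `<=` P -> convex Q -> narrow i w Q -> splits W D Q) ->
  splits W D P.
Proof.
elim: m P => [|m IH] P PS cP [a Ha] small.
  by apply: small => //; exists a; rewrite -[w]mul1r.
pose c := a + 2 ^+ m * w.
pose L := [set y : E | y ord0 i <= c]; pose U := [set y : E | c <= y ord0 i].
have -> : P = P `&` (L `|` U).
  apply/seteqP; split=> [y Py|y []//]; split=> //.
  by rewrite /L /U /=; case: (leP (y ord0 i) c) => [|/ltW]; [left|right].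
have cL : convex L by exact: convex_coord_le.
have cU : convex U by exact: convex_coord_ge.
apply: splits_glue.
- exact: cocycle_cover_sub.
- exact: closed_coord_le.
- exact: closed_coord_ge.
- apply: IH.
  + by move=> y [/PS].
  + exact: convexI.
  + by exists a => y [/Ha /andP[-> _] Ly].
  + by move=> Q QP; apply: small => y /QP[].
- apply: IH.
  + by move=> y [/PS].
  + exact: convexI.
  + exists c => y [/Ha /andP[_ ya] Uy]; apply/andP; split => //.
    by apply: le_trans ya _; rewrite /c exprS; lra.
  + by move=> Q QP; apply: small => y /QP[].
- by apply: convex_connected; apply: convexI => //; apply: convexI.
Qed.

Lemma splits_mesh (l : seq 'I_n) (w : R) (P : set E) : 0 < w ->
  P `<=` S -> convex P -> (forall i, exists v, narrow i v P) ->
  (forall Q, Q `<=` P -> convex Q -> (forall i, i \in l -> narrow i w Q) ->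
    splits W D Q) ->
  splits W D P.
Proof.
move=> w0; elim: l P => [|i l IH] P PS cP bP small; first exact: small.
have [v Pv] := bP i.
have [m vm] : exists m, v <= 2 ^+ m * w.
  exists (Num.bound (v / w)); rewrite -ler_pdivrMr//.
  have [v0|v0] := leP 0 (v / w).
    apply: ltW; apply: lt_le_trans (archi_boundP v0) _.
    by rewrite -natrX ler_nat ltnW// ltn_expl.
  by apply: le_trans (ltW v0) _; rewrite exprn_ge0.
apply: (@splits_halving i w m) => //.
  case: Pv => a Ha; exists a => y /Ha /andP[-> ya] /=.
  by apply: le_trans ya _; rewrite lerD2l.
move=> Q QP cQ Qi; apply: IH => //.
- by move=> y /QP /PS.
- by move=> j; have [u Pu] := bP j; exists u; apply: narrow_sub Pu.
- move=> Q' Q'Q cQ' H; apply: small => //.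
    by move=> y /Q'Q /QP.
  move=> j; rewrite inE => /orP[/eqP ->|]; last exact: H.
  exact: narrow_sub Qi.
Qed.

(** Branches exist over small balls, whose radius can be chosen uniformly by
    compactness of S; a convex set is cut into pieces of smaller diameter. *)
Lemma splits_convex P : compact S -> P `<=` S -> convex P ->
  (forall i, exists w, narrow i w P) -> splits W D P.
Proof.
move=> Sc PS cP bP.
have [e e0 He] : exists2 e : R, 0 < e &
    forall x, S x -> splits W D (S `&` ball x e).
  have H : \forall e \near (0 : R)^'+, forall x, S x ->
      splits W D (S `&` ball x e).
    move: (Sc) => /compact_near_coveringP.
    apply=> x Sx; have [b bx] := cover_total S_cover Sx.
    have /nbhs_ballP[e /= e0 He] := cover_open S_cover Sx bx.
    exists (ball x (e / 2), [set d | 0 < d < e / 2]) => /=.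
      split; first by apply: nbhsx_ballx; rewrite divr_gt0.
      near=> d; apply/andP; split => //.
      by near: d; apply: nbhs_right_lt; rewrite divr_gt0.
    move=> [x' d] [/= xx' /andP[d0 de]].
    apply: splits_sub (splits_chart b S_cover) => y [Sy x'y]; split=> //.
    apply: He => //; apply: ball_split xx' _.
    by apply: le_ball x'y; exact: ltW.
  near ((0 : R)^'+) => e; exists e => //.
  by near: e; exact: H.
apply: (@splits_mesh (enum 'I_n) (e / 2)) => //; first by rewrite divr_gt0.
move=> Q QP cQ Qn; have [[x Qx]|Q0] := pselect (Q !=set0); last first.
  by exists (fun _ _ => 0); split=> [y b c Qy|b y [Qy _]]; case: Q0; exists y.
apply: splits_sub (He x (PS x (QP x Qx))) => y Qy.
split; first exact: PS (QP y Qy).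
split => // i j; rewrite (ord1 i).
have [a Ha] := Qn j (mem_enum _ _).
have /andP[xa ax] := Ha x Qx; have /andP[ya ay] := Ha y Qy.
by rewrite /ball /= ltr_norml; apply/andP; split; lra.
Unshelve. all: by end_near.
Qed.

End Subdivision.

(** * Branches over a cubical shell *)

Section Shell.
Context (R : realType) (n : nat).
Local Notation E := 'rV[R]_n.
Local Notation side := ('I_n * bool)%type.
Variables (p : E) (r d : R).
Hypotheses (d0 : 0 < d) (dr : d <= r).
Implicit Types (y : E) (k l : side) (L : seq side).

Definition cube : set E := [set y | forall i, `|y ord0 i - p ord0 i| <= r].

(** The sign of the side k is plus when k.2 is false. *)
Definition slab k : set E :=
  [set y | d <= (-1) ^+ k.2 * (y ord0 k.1 - p ord0 k.1)].

Definition shell : set E :=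
  cube `&` [set y | exists i, d <= `|y ord0 i - p ord0 i|].

Definition slab_union L : set E := [set y | exists2 k, k \in L & slab k y].

Lemma slab_coord k : slab k =
  if k.2 then [set y | y ord0 k.1 <= p ord0 k.1 - d]
  else [set y | p ord0 k.1 + d <= y ord0 k.1].
Proof.
case: k => i [] /=; apply/seteqP; split=> y; rewrite /slab /=;
  rewrite ?expr0 ?expr1; lra.
Qed.

Lemma convex_slab k : convex (slab k).
Proof.
rewrite slab_coord.
by case: k.2; [exact: convex_coord_le|exact: convex_coord_ge].
Qed.

Lemma closed_slab k : closed (slab k).
Proof.
rewrite slab_coord.
by case: k.2; [exact: closed_coord_le|exact: closed_coord_ge].
Qed.

Lemma convex_cube : convex cube.
Proof.
move=> x y t cx cy t01 i; move: (cx i) (cy i) t01; rewrite segmentE !ler_norml.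
by move=> /andP[x1 x2] /andP[y1 y2] /andP[t0 t1]; apply/andP; split; nra.
Qed.

Lemma shell_slabE k : shell `&` slab k = cube `&` slab k.
Proof.
apply/seteqP; split=> y [] => [[cy _] hy|cy hy]; split=> //; split=> //.
exists k.1; apply: le_trans hy _.
by rewrite (le_trans (ler_norm _))// normrM normrX normrN1 expr1n mul1r.
Qed.

Lemma convex_shell_slab k : convex (shell `&` slab k).
Proof.
by rewrite shell_slabE; apply: convexI; [exact: convex_cube|exact: convex_slab].
Qed.

Lemma compact_cube : compact cube.
Proof.
rewrite (_ : cube = [set y : E | forall i,
    `[p ord0 i - r, p ord0 i + r]%classic (y ord0 i)]).
  apply: (@rV_compact R n (fun i => `[p ord0 i - r, p ord0 i + r]%classic)).
  by move=> i; exact: segment_compact.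
by apply/seteqP; split=> y H i; have := H i;
  rewrite /= in_itv /= ler_distl.
Qed.

Lemma compact_shell : compact shell.
Proof.
have -> : shell = cube `&` ~` ball p d.
  apply/seteqP; split=> y [cy H]; split=> //.
    case: H => i di [_ /(_ ord0 i)]; rewrite /ball /= distrC.
    by rewrite ltNge di.
  apply: contrapT => H'; apply: H; split=> // i j; rewrite (ord1 i) /ball /=.
  by rewrite distrC ltNge; apply/negP => dj; apply: H'; exists j.
apply: (@subclosed_compact _ _ cube); last by move=> y [].
  apply: closedI; last by rewrite closedC; exact: ball_open.
  apply: compact_closed; [exact: norm_hausdorff|exact: compact_cube].
exact: compact_cube.
Qed.

(** These points witness that slabs in different directions meet. *)
Definition corner (s : 'I_n -> bool) : E := \row_i (p ord0 i + (-1) ^+ s i * d).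

Lemma cornerE s i : corner s ord0 i - p ord0 i = (-1) ^+ s i * d.
Proof. by rewrite mxE addrC addKr. Qed.

Lemma slab_corner s k : s k.1 = k.2 -> slab k (corner s).
Proof.
by rewrite /slab /= cornerE => ->; rewrite mulrA -expr2 sqrr_sign mul1r.
Qed.

Lemma cube_corner s : cube (corner s).
Proof.
by move=> i; rewrite cornerE normrM normrX normrN1 expr1n mul1r gtr0_norm.
Qed.

Lemma opposite_slabs i s t : s != t -> slab (i, s) `&` slab (i, t) = set0.
Proof.
move=> st; apply/seteqP; split=> // y [].
have nd : ~~ (d <= 0) by rewrite -ltNge.
move: st; rewrite /slab /=; case: s; case: t => // _; rewrite expr0 expr1.
  by move=> h1 h2; apply: (negP nd); lra.
by move=> h1 h2; apply: (negP nd); lra.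
Qed.

(** A combinatorial certificate that a slab in the direction j meets the union
    of the slabs in L in a connected set: it is disjoint from the opposite slab
    and meets each other slab in a convex set, and each of these convex sets,
    apart from the first, meets a previous one because three slabs in different
    directions have a common corner. The list is read from its end. *)
Fixpoint linked (j : 'I_n) L : bool := if L is k :: L' then
    linked j L' && [|| k.1 == j,
      has (fun l => (l.1 != k.1) && (l.1 != j)) L'
    | all (fun l => l.1 == j) L']
  else true.

Lemma slab_union_cons k L : slab_union (k :: L) = slab k `|` slab_union L.
Proof.
apply/seteqP; split=> y.
  by case=> l; rewrite inE => /orP[/eqP ->|lL] ly; [left|right; exists l].
case=> [ky|[l lL ly]]; [exists k|exists l] => //.
  by rewrite inE eqxx.
by rewrite inE lL orbT.
Qed.

Lemma closed_slab_union L : closed (slab_union L).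
Proof.
elim: L => [|k L IH]; last first.
  by rewrite slab_union_cons; apply: closedU => //; exact: closed_slab.
rewrite (_ : slab_union _ = set0); first exact: closed0.
by apply/seteqP; split=> // y [].
Qed.

Lemma connected_slab_union k L : k \notin L -> linked k.1 L ->
  connected (shell `&` (slab k `&` slab_union L)).
Proof.
have empty L' : k \notin L' -> all (fun l => l.1 == k.1) L' ->
    slab k `&` slab_union L' = set0.
  move=> kL' allL'; apply/seteqP; split=> // y [ky [l lL' ly]].
  have lk : l.1 = k.1 by apply/eqP; apply: (allP allL').
  have : l != k by apply: contraNneq kL' => <-.
  case: l k ly ky lk {kL' allL' lL'} => [i s] [i' t] /= hs ht ii st.
  rewrite ii in hs st.
  have : (slab (i', s) `&` slab (i', t)) y by [].
  by rewrite opposite_slabs//; move: st; apply: contraNneq => ->.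
elim: L => [_ _|l L IH].
  by rewrite (empty [::])// setI0; exact: connected0.
rewrite inE negb_or => /andP[kl kL] /= /andP[ch lL].
have {}IH := IH kL ch.
rewrite slab_union_cons setIUr.
have [lk|lk] := eqVneq l.1 k.1.
  have -> : slab k `&` slab l = set0.
    have := @empty [:: l]; rewrite inE/= lk eqxx => /(_ kl isT).
    rewrite slab_union_cons (_ : slab_union [::] = set0) ?setU0//.
    by apply/seteqP; split=> // y [].
  by rewrite set0U.
have conv : connected (shell `&` (slab k `&` slab l)).
  apply: convex_connected; rewrite setIA; apply: convexI.
    exact: convex_shell_slab.
  exact: convex_slab.
move: lL; rewrite (negbTE lk) /= => /orP[/hasP[m mL /andP[ml mk]]|/empty ->//].
  rewrite setIUr; apply: connectedU => //.
  pose s i := if i == k.1 then k.2 else if i == l.1 then l.2 else m.2.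
  have sk : slab k (corner s) by apply: slab_corner; rewrite /s eqxx.
  have sl : slab l (corner s).
    by apply: slab_corner; rewrite /s (negbTE lk) eqxx.
  have sm : slab m (corner s).
    by apply: slab_corner; rewrite /s (negbTE ml) (negbTE mk).
  have ss : shell (corner s).
    have : (cube `&` slab k) (corner s) by split=> //; exact: cube_corner.
    by rewrite -shell_slabE => -[].
  by exists (corner s); split; split=> //; split=> //; exists m.
by rewrite setU0.
Qed.

(** The slabs of such a list can be glued one after the other, starting from
    the end of the list. The condition that k is not in L' makes the slab k
    disjoint from those of L' in the same direction. *)
Fixpoint shelling L : bool :=
  if L is k :: L' then [&& shelling L', linked k.1 L' & k \notin L'] else true.

Section Splitting.
Context (V : Type) (A : zmodType) (W : V -> set E) (D : V -> V -> A).
Hypothesis shell_cover : cocycle_cover W D shell.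

Lemma splits_slab_union L : shelling L -> splits W D (shell `&` slab_union L).
Proof.
elim: L => [_|k L IH /= /and3P[sL cL kL]].
  by exists (fun _ _ => 0); split=> [y b c [_ []]//|b y [[_ []]]].
rewrite slab_union_cons; apply: splits_glue => //.
- exact: closed_slab.
- exact: closed_slab_union.
- apply: (splits_convex shell_cover compact_shell).
  + by move=> y [].
  + exact: convex_shell_slab.
  + move=> i; exists (2 * r), (p ord0 i - r) => y [[/(_ i) + _] _].
    by rewrite ler_norml => /andP[y1 y2]; apply/andP; split; lra.
- exact: IH.
- exact: connected_slab_union.
Qed.

End Splitting.
End Shell.

Section SpatialShell.
Context (R : realType) (V : Type) (A : zmodType).
Variables (p : 'rV[R]_3) (r d : R).
Variables (W : V -> set 'rV[R]_3) (D : V -> V -> A).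

(** The first cohomology of the punctured space vanishes. With only two
    directions the last slab would meet the previous ones in two components,
    and indeed the punctured plane has cohomology. *)
Lemma splits_shell : 0 < d -> d <= r -> cocycle_cover W D (shell p r d) ->
  splits W D (shell p r d).
Proof.
move=> d0 dr cov.
pose x : 'I_3 := @Ordinal 3 0 isT.
pose y : 'I_3 := @Ordinal 3 1 isT.
pose z : 'I_3 := @Ordinal 3 2 isT.
(* Read from the end: a first slab, its four neighbours, the opposite slab. *)
pose L := [:: (z, true); (y, true); (x, true);
              (y, false); (x, false); (z, false)].
have -> : shell p r d = shell p r d `&` slab_union p d L.
  2: exact: splits_slab_union.
apply/seteqP; split=> [w sw|w []//]; split=> //.
case: (sw) => _ [i di].
exists (i, w ord0 i - p ord0 i < 0).
  by case: (_ < _); case: i {di} => -[|[|[|//]]].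
rewrite /slab /=; move: di; case: ltP => [w0|w0].
  by rewrite ltr0_norm// expr1 mulN1r.
by rewrite ger0_norm// expr0 mul1r.
Qed.

End SpatialShell.

(** * Points of the realization near a vertex *)

Section RealizationPoints.
Context (R : realType) (V : finType) (K : {set {set V}}).
Local Notation E := 'rV[R]_#|V|.
Implicit Types (v b c w : V) (s : {set V}) (x : E).

Definition vertex_point v : E := delta_mx ord0 (enum_rank v).

Lemma barycentric_vertex v w : barycentric (vertex_point v) w = (w == v)%:R.
Proof. by rewrite /barycentric mxE eqxx (inj_eq enum_rank_inj). Qed.

Lemma barycentricD x y w :
  barycentric (x + y) w = barycentric x w + barycentric y w.
Proof. by rewrite /barycentric mxE. Qed.

Lemma barycentricZ (t : R) x w : barycentric (t *: x) w = t * barycentric x w.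
Proof. by rewrite /barycentric mxE. Qed.

Lemma barycentricP x y : (forall w, barycentric x w = barycentric y w) -> x = y.
Proof.
move=> H; apply/rowP => i; have := H (enum_val i).
by rewrite /barycentric enum_valK.
Qed.

Lemma barycentric_continuous w : continuous (fun x : E => barycentric x w).
Proof. exact: coord_continuous. Qed.

Hypothesis K_complex : simplicial_complex K.

Lemma realization_simplex s x : s \in K -> (forall w, 0 <= barycentric x w) ->
  \sum_w barycentric x w = 1 -> (forall w, barycentric x w != 0 -> w \in s) ->
  realization K x.
Proof.
move=> sK x0 x1 xs; split=> //; apply: K_complex.2 sK _ _.
  by apply/fintype.subsetP => w; rewrite inE; exact: xs.
apply/negP => /eqP S0; have : (1 : R) != 0 by exact: oner_neq0.
rewrite -x1 big1 ?eqxx// => w _; apply/eqP/negPn/negP => xw.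
suff : w \in (finset.set0 : {set V}) by rewrite inE.
by rewrite -S0 inE.
Qed.

Lemma realization_support x s : realization K x ->
  (forall w, w \in s -> barycentric x w != 0) -> s != finset.set0 -> s \in K.
Proof.
move=> [_ _ xK] xs s0; apply: K_complex.2 xK _ s0.
by apply/fintype.subsetP => w ws; rewrite inE xs.
Qed.

Lemma realization_vertex x v : realization K x ->
  (forall w, w != v -> barycentric x w = 0) -> x = vertex_point v.
Proof.
move=> [_ x1 _] xv; apply: barycentricP => w; rewrite barycentric_vertex.
have [->|/xv//] := eqVneq w v.
by rewrite -x1 (bigD1 v)//= big1 ?addr0.
Qed.

(** The edge bc of the link of v, shrunk towards v by the factor e and
    parametrised by t from b to c. *)
Definition link_point (e : R) v b c (t : R) : E :=
  (1 - e) *: vertex_point v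
  + e *: (vertex_point b + t *: (vertex_point c - vertex_point b)).

Lemma link_pointE e v b c t w : barycentric (link_point e v b c t) w =
  (1 - e) * (w == v)%:R + e * ((1 - t) * (w == b)%:R + t * (w == c)%:R).
Proof.
rewrite !(barycentricD, barycentricZ) !barycentric_vertex.
have -> : barycentric (- vertex_point b) w = - (w == b)%:R.
  by rewrite -scaleN1r barycentricZ barycentric_vertex mulN1r.
ring.
Qed.

Lemma link_point_sym e v b c t :
  link_point e v b c t = link_point e v c b (1 - t).
Proof. by apply: barycentricP => w; rewrite !link_pointE; ring. Qed.

Lemma link_point0 e v b c : link_point e v b c 0 = link_point e v b b 0.
Proof. by apply: barycentricP => w; rewrite !link_pointE; ring. Qed.

Lemma link_point_continuous e v b c : continuous (link_point e v b c).
Proof.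
move=> t; apply: cvgD; first exact: cvg_cst.
apply: cvgZl_tmp; apply: cvgD; first exact: cvg_cst.
exact: cvgZr_tmp.
Qed.

Lemma link_point_realization e v b c t : [set v; b; c]%SET \in K ->
  0 < e < 1 -> 0 <= t <= 1 -> realization K (link_point e v b c t).
Proof.
move=> sK /andP[e0 e1] /andP[t0 t1]; apply: realization_simplex sK _ _ _.
- move=> w; rewrite link_pointE.
  by case: (w == v); case: (w == b); case: (w == c); rewrite /=; nra.
- have sum1 u : \sum_w (w == u)%:R = 1 :> R.
    rewrite (bigD1 u)//= eqxx big1 ?addr0// => w /negbTE -> //.
  under eq_bigr do rewrite link_pointE.
  rewrite big_split/= -!mulr_sumr big_split/= -!mulr_sumr !sum1; ring.
- move=> w; rewrite link_pointE !inE; apply: contraNT.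
  rewrite !negb_or => /andP[/andP[/negbTE-> /negbTE->] /negbTE->].
  by rewrite !(mulr0, addr0).
Qed.

Lemma link_point_apex e v b c t : b != v -> c != v ->
  barycentric (link_point e v b c t) v = 1 - e.
Proof.
rewrite link_pointE eqxx => /negbTE bv /negbTE cv.
by rewrite ![v == _]eq_sym bv cv /=; ring.
Qed.

Lemma link_point_left e v b c t : b != v -> 0 < e -> 0 <= t < 1 ->
  0 < barycentric (link_point e v b c t) b.
Proof.
move=> /negbTE bv e0 /andP[t0 t1]; rewrite link_pointE eqxx bv.
by case: (b == c) => /=; nra.
Qed.

Lemma link_point_near e v b c t (h : R) : b != v -> c != v ->
  0 < e < h -> 0 <= t <= 1 -> ball (vertex_point v) h (link_point e v b c t).
Proof.
move=> /negbTE bv /negbTE cv /andP[e0 eh] /andP[t0 t1].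
split=> [|i j]; first exact: lt_trans eh.
rewrite (ord1 i) -[j]enum_valK; set w := enum_val j.
rewrite /ball /= -/(barycentric _ w) -/(barycentric (link_point _ _ _ _ _) w).
rewrite barycentric_vertex link_pointE.
have [->|wv] := eqVneq w v.
  rewrite ![v == _]eq_sym bv cv /= ltr_norml; apply/andP; split; lra.
rewrite /= ltr_norml.
by case: (w == b); case: (w == c); rewrite /=; apply/andP; split; nra.
Qed.

End RealizationPoints.

(** * Cocycles on the link of a vertex *)

Section VertexLink.
Context (R : realType) (V : finType) (K : {set {set V}}) (A : zmodType).
Variables (v : V) (D : V -> V -> A).
Hypothesis K_complex : simplicial_complex K.
Hypothesis D_cocycle : forall b c d, b != v -> c != v -> d != v ->
  vset v b c d \in K -> D b c + D c d = D b d.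

Local Notation E := 'rV[R]_#|V|.
Local Notation X := (realization K : set E).
Local Notation pv := (vertex_point R v).

Section Chart.
Variables (U : set E) (O : set 'rV[R]_3).
Variables (f : E -> 'rV[R]_3) (g : 'rV[R]_3 -> E).
Hypotheses (Uop : open U) (Oop : open O) (Uv : U pv) (Xv : X pv).
Hypothesis fcont : forall x, (X `&` U) x ->
  f @ within (X `&` U) (nbhs x) --> f x.
Hypothesis gcont : forall y, O y -> g @ within O (nbhs y) --> g y.
Hypothesis fg : forall x, (X `&` U) x -> O (f x) /\ g (f x) = x.
Hypothesis gf : forall y, O y -> (X `&` U) (g y) /\ f (g y) = y.

Definition chart_star b : set 'rV[R]_3 :=
  [set y | b != v /\ 0 < barycentric (g y) b].

Lemma chart_near_gt w (a : R) y : O y -> a < barycentric (g y) w ->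
  \forall z \near y, O z /\ a < barycentric (g z) w.
Proof.
move=> Oy ay; have Onear : \forall z \near y, O z by exact: open_nbhs_nbhs.
have gnear : \forall x \near g y, a < barycentric x w.
  apply: (@barycentric_continuous R V w (g y) [set t | a < t]).
  by apply: open_nbhs_nbhs; split=> //; exact: open_gt.
have H : \forall z \near y, O z -> a < barycentric (g z) w.
  exact: gcont Oy _ gnear.
by apply: filterS2 Onear H => z Oz H; split=> //; exact: H.
Qed.

(** Points of the shell do not correspond to v, so they have a positive
    coordinate at some other vertex; the cube is small enough for the
    coordinate at v to be positive as well, so that the vertices with positive
    coordinates span a simplex containing v, on which D is a cocycle. *)
Lemma chart_cover r d : 0 < d ->
  (forall y, cube (f pv) r y -> O y /\ 0 < barycentric (g y) v) ->
  cocycle_cover chart_star D (shell (f pv) r d).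
Proof.
move=> d0 hr; split.
- move=> b y [/hr[Oy _] _] [bv by0].
  by apply: filterS (chart_near_gt Oy by0) => z [].
- move=> y [/hr[Oy _] [i di]].
  have [[gX gU] gfy] := gf Oy.
  apply: contrapT => nob.
  have gv : g y = pv.
    apply: (realization_vertex gX) => w wv; apply/eqP/negPn/negP => w0.
    apply: nob; exists w; split=> //; rewrite lt_def w0.
    by case: gX => + _ _; apply.
  by move: di; rewrite -gv gfy subrr normr0 leNgt d0.
- move=> y b c e [/hr[Oy y0] _] [bv yb] [cv yc] [ev ye].
  apply: D_cocycle => //; have [[gX _] _] := gf Oy.
  apply: realization_support gX _ _ => //.
    by move=> w; rewrite !inE -!orbA => /or4P[]/eqP->; rewrite gt_eqF.
  by apply/set0Pn; exists v; rewrite !inE eqxx.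
Qed.

Lemma chart_radius : exists2 r : R, 0 < r &
  forall y, cube (f pv) r y -> O y /\ 0 < barycentric (g y) v.
Proof.
have [Op gp] := fg (conj Xv Uv).
have : 0 < barycentric (g (f pv)) v.
  by rewrite gp barycentric_vertex eqxx ltr01.
move=> /(chart_near_gt Op) /nbhs_ballP[r /= r0 Hr].
exists (r / 2); first by rewrite divr_gt0.
move=> y yr; apply: Hr; split=> // i j; rewrite (ord1 i) /ball /=.
by rewrite distrC (le_lt_trans (yr j))// ltr_pdivrMr// mulr_natr mulr2n ltrDl.
Qed.

Lemma chart_inner_radius r e : 0 < r -> 0 < e ->
  exists d : R, 0 < d <= r /\ forall y, O y ->
    (forall i, `|y ord0 i - f pv ord0 i| < d) -> 1 - e < barycentric (g y) v.
Proof.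
move=> r0 e0; have [Op gp] := fg (conj Xv Uv).
have : 1 - e < barycentric (g (f pv)) v.
  by rewrite gp barycentric_vertex eqxx/= ltrBlDr ltrDl.
move=> /(chart_near_gt Op) /nbhs_ballP[d /= d0 Hd].
exists (Num.min d r); split; first by rewrite lt_min d0 r0 ge_min lexx orbT.
move=> y Oy yd; apply: (Hd y _).2; split=> // i j; rewrite (ord1 i) /ball /=.
by rewrite distrC (lt_le_trans (yd j))// ge_min lexx.
Qed.

Lemma chart_link_radius r : 0 < r -> exists e : R, 0 < e < 1 /\
  forall b c t, b != v -> c != v -> [set v; b; c]%SET \in K -> 0 <= t <= 1 ->
    (X `&` U) (link_point e v b c t)
    /\ cube (f pv) r (f (link_point e v b c t)).
Proof.
move=> r0.
have fnear : \forall y \near f pv, cube (f pv) r y.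
  apply/nbhs_ballP; exists r => //= y [_ yr] i; have := yr ord0 i.
  by rewrite /ball /= distrC => /ltW.
have Unear : \forall x \near pv, U x by exact: open_nbhs_nbhs.
have H : \forall x \near pv, (X `&` U) x -> cube (f pv) r (f x).
  exact: fcont (conj Xv Uv) _ fnear.
have : \forall x \near pv, U x /\ ((X `&` U) x -> cube (f pv) r (f x)).
  by apply: filterS2 Unear H.
move=> /nbhs_ballP[h /= h0 Hh].
exists (Num.min (h / 2) (1 / 2)).
set e := Num.min _ _.
have e0 : 0 < e by rewrite lt_min !divr_gt0.
have eh : e < h by rewrite gt_min; apply/orP; left; lra.
have e1 : e < 1 by rewrite gt_min; apply/orP; right; lra.
split; first by rewrite e0 e1.
move=> b c t bv cv bcK t01.
have Xx : X (link_point e v b c t).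
  by apply: link_point_realization => //; rewrite e0 e1.
have [Ux fx] : U (link_point e v b c t) /\
    ((X `&` U) (link_point e v b c t) ->
     cube (f pv) r (f (link_point e v b c t))).
  by apply: Hh; apply: link_point_near => //; rewrite e0 eh.
by split=> //; exact: fx.
Qed.

(** The outer radius r of the shell makes [chart_cover] applicable, the scale e
    then puts the shrunken link inside the outer cube, and the inner radius d
    finally keeps it out of the inner cube: points sent there by the chart have
    coordinate larger than 1 - e at v, which is its value on the shrunken link.
    A branch phi gives m(b) as the value of phi at the vertex b of the shrunken
    link, for the index b. *)
Lemma chart_link_exact : exists m : V -> A, forall b c,
  b != v -> c != v -> [set v; b; c]%SET \in K -> D b c = m c - m b.
Proof.
have [r r0 hr] := chart_radius.
have [e [e01 he]] := chart_link_radius r0.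
have [e0 e1] := andP e01.
have [d [/andP[d0 dr] hd]] := chart_inner_radius r0 e0.
have [phi [jump cst]] := splits_shell d0 dr (chart_cover d0 hr).
pose x b c t := link_point e v b c t.
have shell_x b c t : b != v -> c != v -> [set v; b; c]%SET \in K ->
    0 <= t <= 1 -> shell (f pv) r d (f (x b c t)).
  move=> bv cv bcK t01; have [XUx cx] := he b c t bv cv bcK t01.
  split=> //; apply: contrapT => nod; have [Ox gx] := fg XUx.
  have : 1 - e < barycentric (g (f (x b c t))) v.
    apply: hd => // i; rewrite ltNge; apply/negP => di; apply: nod; by exists i.
  by rewrite gx link_point_apex// ltxx.
have star_x b c t : b != v -> c != v -> [set v; b; c]%SET \in K -> 0 <= t < 1 ->
    chart_star b (f (x b c t)).
  move=> bv cv bcK /andP[t0 t1]; have [|XUx _] := he b c t bv cv bcK.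
    by rewrite t0 ltW.
  have [_ gx] := fg XUx; split=> //; rewrite gx.
  by apply: link_point_left => //; rewrite t0.
have half01 : 0 <= (2^-1 : R) < 1 by apply/andP; split; lra.
pose m b := phi (f (x b b 0)) b.
(* The index b is available on the half of the edge bc next to b, so the value
   m b propagates to the midpoint, where it is compared with m c. *)
have mid b c : b != v -> c != v -> [set v; b; c]%SET \in K ->
    phi (f (x b c 2^-1)) b = m b.
  move=> bv cv bcK; rewrite /m /x -(link_point0 e v b c).
  apply: (@connected_locally_constant R A `[0, 2^-1]%classic
    (fun t => phi (f (link_point e v b c t)) b) _ _ 2^-1 0).
  - exact: segment_connected.
  - move=> t /=; rewrite in_itv /= => /andP[t0 t1].
    have t01 : 0 <= t <= 1 by rewrite t0 (le_trans t1)// ltW//; lra.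
    have [XUt _] := he b c t bv cv bcK t01.
    have st : (shell (f pv) r d `&` chart_star b) (f (x b c t)).
      by split; [exact: shell_x|apply: star_x => //; rewrite t0; lra].
    have H1 : \forall y \near x b c t, (X `&` U) y ->
        (shell (f pv) r d `&` chart_star b) (f y) ->
        phi (f y) b = phi (f (x b c t)) b.
      exact: fcont XUt _ (cst b _ st).
    have H2 : \forall s \near t, (X `&` U) (x b c s) ->
        (shell (f pv) r d `&` chart_star b) (f (x b c s)) ->
        phi (f (x b c s)) b = phi (f (x b c t)) b.
      exact: (link_point_continuous H1).
    apply: filterS H2 => s H2; rewrite in_itv /= => /andP[s0 s1].
    have s01 : 0 <= s <= 1 by rewrite s0 (le_trans s1)// ltW//; lra.
    apply: H2; first by have [] := he b c s bv cv bcK s01.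
    by split; [exact: shell_x|apply: star_x => //; rewrite s0; lra].
  - by rewrite /= in_itv /= lexx andbT; lra.
  - by rewrite /= in_itv /= lexx /=; lra.
exists m => b c bv cv bcK.
have cbK : [set v; c; b]%SET \in K by rewrite finset.setUAC.
have E : x b c 2^-1 = x c b 2^-1.
  by rewrite /x link_point_sym; congr link_point; lra.
rewrite -(mid b c)// -(mid c b)// -E jump//.
- by apply: shell_x => //; case/andP: half01 => -> /ltW ->.
- exact: star_x.
- by rewrite E; exact: star_x.
Qed.

End Chart.

(** The first cohomology of the link of a vertex vanishes. The cocycle condition
    is also imposed on degenerate triangles, where it says that D b b = 0 and
    D c b = - D b c. *)
Lemma link_cocycle_exact : topological_manifold 3 X -> [set v]%SET \in K ->
  exists m : V -> A, forall b c,
    b != v -> c != v -> [set v; b; c]%SET \in K -> D b c = m c - m b.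
Proof.
move=> manif vK.
have Xv : X pv.
  apply: (realization_simplex K_complex vK) => [w| |w].
  - by rewrite barycentric_vertex ler0n.
  - rewrite (bigD1 v)//= barycentric_vertex eqxx big1 ?addr0// => w /negbTE wv.
    by rewrite barycentric_vertex wv.
  - by rewrite barycentric_vertex inE pnatr_eq0 eqb0 negbK.
have [U [Y [Uop Uv Oop [f [g [fc gc fg gf]]]]]] := manif pv Xv.
apply: (@chart_link_exact U Y f g) => //.
- by move/subspace_continuousP: fc.
- by move/subspace_continuousP: gc.
Qed.

End VertexLink.

Local Close Scope classical_set_scope.

(** * Cyclic sums and orientations *)

(** Partial sums along the cycle; the total sum is the obstruction to closing
    up at the end of the list. *)
Lemma cyclic_primitive (V : eqType) (A : zmodType) (s : seq V) (F : V -> A) :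
  uniq s -> \sum_(c <- s) F c = 0 ->
  exists r : V -> A, forall c, c \in s -> r (next s c) - r c = F c.
Proof.
case: s => [|y p] us s0; first by exists (fun _ => 0).
exists (fun c => \sum_(x <- take (index c (y :: p)) (y :: p)) F x) => c cs.
set i := index c (y :: p).
have ip : (i <= size p)%N
    by rewrite -ltnS -[(size p).+1]/(size (y :: p)) index_mem.
have step : \sum_(x <- take i.+1 (y :: p)) F x
    = \sum_(x <- take i (y :: p)) F x + F c.
  by rewrite (take_nth y) ?index_mem// nth_index// -cats1 big_cat big_seq1.
apply/eqP; rewrite subr_eq [eqbRHS]addrC -step next_nth cs -/i.
move: ip; rewrite leq_eqVlt => /orP[/eqP ip|ip].
  by rewrite nth_default ?ip// /= eqxx take0 big_nil take_size s0.
have -> : nth y p i = nth y (y :: p) i.+1 by [].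
by rewrite index_uniq.
Qed.

Section Orientation.
Context (V : finType) (K : {set {set V}}) (pos : V -> V -> V -> V -> bool).
Hypothesis hpos : orientation K pos.
Implicit Types a b c d e x : V.

Lemma vset_swap12 a b c d : vset b a c d = vset a b c d.
Proof. by apply/setP => x; rewrite !inE; congr (_ || _ || _); exact: orbC. Qed.

Lemma vset_swap23 a b c d : vset a c b d = vset a b c d.
Proof. by apply/setP => x; rewrite !inE; congr (_ || _); exact: orbAC. Qed.

Lemma vset_swap34 a b c d : vset a b d c = vset a b c d.
Proof. by apply/setP => x; rewrite !inE orbAC. Qed.

Lemma pos_rot a b c d : pos a b c d -> pos a c d b.
Proof.
move=> p; have t := pos_simplex hpos p.
by rewrite (pos_swap34 hpos) 1?vset_swap23// (pos_swap23 hpos)// p.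
Qed.

Lemma pos_flip a b c d : pos a b c d -> pos b a d c.
Proof.
move=> p; have t := pos_simplex hpos p.
by rewrite (pos_swap34 hpos) 1?vset_swap12// (pos_swap12 hpos)// p.
Qed.

Lemma pos_cycle a b c d : pos a b c d -> pos b c a d.
Proof. by move=> p; apply/pos_rot/pos_rot/pos_flip. Qed.

Lemma pos_odd a b c d : pos a b c d -> ~~ pos a b d c.
Proof. by move=> p; rewrite (pos_swap34 hpos) ?p// (pos_simplex hpos p). Qed.

Lemma vset_pos a b c d :
  vset a b c d \in simplices K 3 -> pos a b c d || pos a c b d.
Proof. by move=> t; rewrite (pos_swap23 hpos t) orbN. Qed.

Lemma pos_neq12 a b c d : pos a b c d -> a != b.
Proof.
move=> p; apply/negP => /eqP ab; have := pos_swap12 hpos (pos_simplex hpos p).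
by rewrite -ab; case: pos.
Qed.

Lemma pos_neq a b c d : pos a b c d ->
  [/\ [/\ a != b, a != c & a != d], [/\ b != c & b != d] & c != d].
Proof.
move=> p; have q := pos_rot p; have r := pos_flip p.
split; last exact: pos_neq12 (pos_rot (pos_flip (pos_rot (pos_rot r)))).
  split; [exact: pos_neq12 p|exact: pos_neq12 q|exact: pos_neq12 (pos_rot q)].
split; first exact: pos_neq12 (pos_rot (pos_rot r)).
exact: pos_neq12 (pos_rot r).
Qed.

(** An even permutation of four letters fixing one of them is a rotation of the
    other three. *)
Lemma pos_rotation_unique a b c d b' c' d' :
  pos a b c d -> pos a b' c' d' -> vset a b' c' d' = vset a b c d ->
  [\/ [/\ b' = b, c' = c & d' = d], [/\ b' = c, c' = d & d' = b]
    | [/\ b' = d, c' = b & d' = c]].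
Proof.
have fix_b x y z y' z' : pos a x y z -> pos a x y' z' ->
    vset a x y' z' = vset a x y z -> y' = y /\ z' = z.
  move=> p p' E.
  have [[_ ay az] [xy xz] yz] := pos_neq p'.
  have : y' \in vset a x y z by rewrite -E !inE eqxx ?orbT.
  rewrite !inE [_ == a]eq_sym (negbTE ay) [_ == x]eq_sym (negbTE xy) /=.
  have : z' \in vset a x y z by rewrite -E !inE eqxx ?orbT.
  rewrite !inE [_ == a]eq_sym (negbTE az) [_ == x]eq_sym (negbTE xz) /=.
  move=> /orP[]/eqP Ez /orP[]/eqP Ey; subst y' z'; rewrite ?eqxx// in yz *.
  by move: (pos_odd p); rewrite p'.
move=> p p' E.
have [[ab' _ _] _ _] := pos_neq p'.
have : b' \in vset a b c d by rewrite -E !inE eqxx ?orbT.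
rewrite !inE [_ == a]eq_sym (negbTE ab') /= -orbA => /or3P[]/eqP Eb; subst b'.
- by have [-> ->] := fix_b _ _ _ _ _ p p' E; constructor 1.
- have [|-> ->] := fix_b _ _ _ _ _ (pos_rot p) p'; last by constructor 2.
  by rewrite E [RHS]vset_swap34 [RHS]vset_swap23.
- have [|-> ->] := fix_b _ _ _ _ _ (pos_rot (pos_rot p)) p'.
    2: by constructor 3.
  by rewrite E [RHS]vset_swap23 [RHS]vset_swap34.
Qed.

Lemma vsetE a b c d : vset a b c d = (a |: [set b; c; d])%SET.
Proof. by apply/setP => x; rewrite !inE -!orbA. Qed.

Lemma pos_from a b c d x : pos a b c d -> x \in vset a b c d ->
  exists b' c' d', pos x b' c' d' /\ vset x b' c' d' = vset a b c d.
Proof.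
move=> p; have pc := pos_cycle (pos_cycle p).
have pd := pos_flip (pos_rot (pos_rot p)).
rewrite !inE -!orbA => /or4P[]/eqP ->.
- by exists b, c, d.
- by exists a, d, c; split; [exact: pos_flip|rewrite vset_swap12 vset_swap34].
- exists a, b, d; split=> //; by rewrite vset_swap12 vset_swap23.
- exists a, c, b; split=> //; apply/setP => y; rewrite !inE.
  by do 4 case: (y == _).
Qed.

Lemma sum_link (A : zmodType) (F : V -> A) a b c d : pos a b c d ->
  \sum_(y in vset a b c d | y != a) F y = F b + F c + F d.
Proof.
move=> p; have [[ab ac ad] [bc bd] cd] := pos_neq p.
rewrite (bigD1 b)/=; last by rewrite !inE eqxx orbT /= eq_sym.
rewrite -addrA; congr (_ + _).
rewrite (bigD1 c)/=; last by rewrite !inE eqxx orbT /= ![c == _]eq_sym ac bc.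
congr (_ + _).
rewrite (big_pred1 d)// => y; rewrite /= !inE.
have [->|] := eqVneq y a; first by rewrite (negbTE ad) ?andbF.
have [->|] := eqVneq y b; first by rewrite (negbTE bd) ?andbF.
have [->|] := eqVneq y c; first by rewrite (negbTE cd) ?andbF.
by rewrite ?andbT.
Qed.

End Orientation.

(** * Corner potentials and the cancellation over faces *)

Section Angles.
Context (V : finType) (K : {set {set V}}) (pos : V -> V -> V -> V -> bool).
Context (A : zmodType) (k : {set V} -> V -> V -> A).
Hypothesis K_complex : simplicial_complex K.
Hypothesis hpos : orientation K pos.
Hypothesis hk : forall t, t \in simplices K 3 -> angle_structure t (k t).
Hypothesis hangled : angled K pos k.
Implicit Types a b c d e x : V.

Lemma pos_subsimplex a b c d (s : {set V}) : pos a b c d ->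
  s \subset vset a b c d -> s != finset.set0 -> s \in K.
Proof.
move=> /(pos_simplex hpos); rewrite inE => /andP[tK _].
exact: K_complex.2.
Qed.

Lemma pos_edge a b c d : pos a b c d -> [set a; b]%SET \in K.
Proof.
move=> p; apply: (pos_subsimplex p).
  by apply/fintype.subsetP => x; rewrite !inE => ->.
by apply/set0Pn; exists a; rewrite !inE eqxx.
Qed.

Lemma pos_face a b c d : pos a b c d -> [set a; b; c]%SET \in K.
Proof.
move=> p; apply: (pos_subsimplex p).
  by apply/fintype.subsetP => x; rewrite !inE => ->.
by apply/set0Pn; exists a; rewrite !inE eqxx.
Qed.

Lemma angle_sym a b c d : pos a b c d -> angle k b a d c = angle k a b c d.
Proof.
move=> p; have [[ab _ _] _ _] := pos_neq hpos p.
have [+ _] := hk (pos_simplex hpos p); rewrite /angle vset_swap12 vset_swap34.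
by apply; rewrite ?inE ?eqxx ?orbT// eq_sym.
Qed.

Lemma angle_sum a b c d : pos a b c d ->
  angle k a b c d + angle k a c d b + angle k a d b c = 0.
Proof.
move=> p; have [_ /(_ a)] := hk (pos_simplex hpos p).
rewrite (sum_link hpos _ p)// => <-; last by rewrite !inE eqxx.
rewrite /angle; congr (_ + k _ _ _ + k _ _ _).
  by rewrite vset_swap34 vset_swap23.
by rewrite vset_swap23 vset_swap34.
Qed.

(** The angled condition at the edge ab is the vanishing of the sum of the
    increments of r a b around this edge. *)
Lemma edge_potential : exists r : V -> V -> V -> A,
  forall a b c d, pos a b c d -> r a b d - r a b c = angle k a b c d.
Proof.
have H a b : exists r : V -> A,
    forall c d, pos a b c d -> r d - r c = angle k a b c d.
  have [/andP[ab abK]|nab] := boolP ((a != b) && ([set a; b]%SET \in K)).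
    have [s [us sP] s0] := hangled ab abK.
    have [r Hr] := cyclic_primitive us s0.
    by exists r => c d; rewrite sP => /andP[cs /eqP ->]; exact: Hr.
  exists (fun _ => 0) => c d p; case/negP: nab.
  by rewrite (pos_edge p) andbT; have [[]] := pos_neq hpos p.
have /choice[r Hr] : forall ab : V * V, exists r : V -> A,
    forall c d, pos ab.1 ab.2 c d -> r d - r c = angle k ab.1 ab.2 c d.
  by move=> [a b]; exact: H.
by exists (fun a b => r (a, b)) => a b c d; exact: (Hr (a, b)).
Qed.

(** For a positively oriented triangle bcd of the link of a, the cocycle
    condition is the vanishing of the sum of the angles at a. *)
Lemma link_triangle_cocycle (r : V -> V -> V -> A) a b c d :
  (forall a b c d, pos a b c d -> r a b d - r a b c = angle k a b c d) ->
  b != a -> c != a -> d != a -> vset a b c d \in K ->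
  (r a b c - r a c b) + (r a c d - r a d c) = r a b d - r a d b.
Proof.
move=> Hr ba ca da tK.
have cyc x y z : pos a x y z ->
    (r a x y - r a y x) + (r a y z - r a z y) = r a x z - r a z x.
  move=> p; have := angle_sum p.
  rewrite -(Hr _ _ _ _ p) -(Hr _ _ _ _ (pos_rot hpos p)).
  rewrite -(Hr _ _ _ _ (pos_rot hpos (pos_rot hpos p))) => /eqP s0.
  apply/eqP; rewrite eq_sym -subr_eq0 -(eqP s0) !opprD !opprK; apply/eqP.
  exact: (AC (2*(2*2)) ((1*3)*(4*5)*(6*2))).
have [->|bc] := eqVneq b c; first by rewrite subrr add0r.
have [->|cd] := eqVneq c d; first by rewrite subrr addr0.
have [->|bd] := eqVneq b d; first by rewrite addrA subrK !subrr.
have : vset a b c d \in simplices K 3.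
  rewrite inE tK /= /vset [[set a; b; c; d]%SET]finset.setUC cardsU1.
  rewrite [[set a; b; c]%SET]finset.setUC cardsU1 cards2 !inE.
  rewrite !negb_or [a == b]eq_sym ba ca da.
  by rewrite [c == b]eq_sym bc !(eq_sym d) cd bd.
move=> /(vset_pos hpos)/orP[/cyc //|/cyc E].
by rewrite -E addrA [X in X + _]addrA subrK subrr add0r.
Qed.
(** The primitive m a of the cocycle on the link of a turns r a b c, which is
    asymmetric in the edges ab and ac, into a function of the corner a of the
    face abc. *)
Lemma corner_potential (R : realType) :
  topological_manifold 3 (@realization R V K) ->
  exists f : V -> V -> V -> A,
    (forall a b c d, pos a b c d -> f a b d - f a b c = angle k a b c d) /\
    (forall a b c, b != a -> c != a -> [set a; b; c]%SET \in K ->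
      f a b c = f a c b).
Proof.
move=> manif; have [r Hr] := edge_potential.
have H a : exists m : V -> A, forall b c, b != a -> c != a ->
    [set a; b; c]%SET \in K -> r a b c + m b = r a c b + m c.
  have [aK|aK] := boolP ([set a]%SET \in K).
    have [b c d ba ca da tK|m Hm] :=
        @link_cocycle_exact R V K A a (fun b c => r a b c - r a c b) K_complex
          _ manif aK.
      exact: link_triangle_cocycle.
    exists m => b c ba ca bcK; rewrite -(subrK (r a c b) (r a b c)) Hm//.
    by rewrite addrAC subrK addrC.
  exists (fun _ => 0) => b c _ _ bcK; case/negP: aK.
  apply: K_complex.2 bcK _ _.
    by apply/fintype.subsetP => x; rewrite !inE => ->.
  by apply/set0Pn; exists a; rewrite !inE eqxx.
have /choice[m Hm] := H.
exists (fun a b c => r a b c + m a b).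
split=> [a b c d p|a b c]; last exact: Hm.
by rewrite opprD addrACA subrr addr0; exact: Hr.
Qed.

Section Corners.
Variable f : V -> V -> V -> A.
Hypothesis f_angle : forall a b c d, pos a b c d ->
  f a b d - f a b c = angle k a b c d.
Hypothesis f_sym : forall a b c, b != a -> c != a -> [set a; b; c]%SET \in K ->
  f a b c = f a c b.

Definition face_wedge a b c : ext_square A :=
  cyclic_wedge (f a b c) (f b c a) (f c a b).

Lemma face_wedge_rot a b c : face_wedge b c a = face_wedge a b c.
Proof. exact: cyclic_wedge_rot. Qed.

Lemma corner_sym a b c d : pos a b c d -> f a b c = f a c b.
Proof.
move=> p; have [[ab ac _] _ _] := pos_neq hpos p.
by apply: f_sym; [rewrite eq_sym|rewrite eq_sym|exact: pos_face p].
Qed.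

Lemma face_wedge_swap a b c d : pos a b c d ->
  face_wedge b a c = - face_wedge a b c.
Proof.
move=> p; have q := pos_cycle hpos p.
rewrite /face_wedge -cyclic_wedge_swap (corner_sym p) (corner_sym q).
by rewrite (corner_sym (pos_cycle hpos q)).
Qed.

(** The twelve potentials of the tetrahedron abcd are expressed by
    the four f a b c, f b a c, f c b a, f d a b and the angles at ab, ac and
    bc. The symmetry of the angles lets each of them be computed at both ends
    of its edge, which relates the potentials at different vertices. *)
Lemma tetrahedron_faces a b c d : pos a b c d ->
  wedge (angle k a b c d) (angle k a c d b) *+ 4
  + wedge (angle k a d b c) (angle k a d b c)
  + wedge (angle k b c a d) (angle k b c a d)
  = face_wedge b c d + face_wedge a d c + face_wedge d a b + face_wedge c b a.
Proof.
move=> p.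
have pa' := pos_rot hpos p; have pa'' := pos_rot hpos pa'.
have pb := pos_flip hpos p; have pb' := pos_rot hpos pb.
have pb'' := pos_rot hpos pb'.
have pc := pos_cycle hpos pb''; have pc' := pos_rot hpos pc.
have pd := pos_flip hpos pa''; have pd'' := pos_rot hpos (pos_rot hpos pd).
set x := angle k a b c d; set y := angle k a c d b; set s := angle k b c a d.
have zE : angle k a d b c = - (x + y).
  by apply/eqP; rewrite -addr_eq0 addrC angle_sum.
have uE : angle k b d c a = - (x + s).
  apply/eqP; rewrite -addr_eq0; apply/eqP.
  by rewrite -(angle_sum pb) (angle_sym p) addrCA addrA.
have sE : s + s = - (x + y) - (x + y).
  have := angle_sum pd; rewrite (angle_sym pa'') zE (angle_sym pb') uE.
  rewrite (angle_sym (pos_rot hpos pc')).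
  have -> : angle k c d a b = - (y + s).
    apply/eqP; rewrite -addr_eq0 addrC; apply/eqP.
    by rewrite -(angle_sum pc) (angle_sym pa') (angle_sym pb'').
  move=> E; rewrite -[LHS]addr0 -E !opprD.
  rewrite (AC (2*(2*2*2)) ((1*6)*(2*8)*((3*4)*(7*5)))) /= !subrr add0r.
  by rewrite add0r.
have Ea : f a b d = f a b c + x by rewrite /x -(f_angle p) addrC subrK.
have Ea' : f a d c = f a b c - y.
  rewrite /y -(f_angle pa') (corner_sym p) (corner_sym pa').
  by rewrite opprB addrC subrK.
have Eb : f b c d = f b a c + s.
  by rewrite /s -(f_angle pb'') (corner_sym pb'') addrC subrK.
have Eb' : f b d a = f b a c - x.
  by rewrite /x -(angle_sym p) -(f_angle pb) (corner_sym pb) opprB addrC subrK.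
have Ec : f c a d = f c b a + y.
  by rewrite /y -(angle_sym pa') -(f_angle pc) (corner_sym pc) addrC subrK.
have Ec' : f c d b = f c b a - s.
  rewrite /s -(angle_sym pb'') -(f_angle pc') (corner_sym pc').
  by rewrite opprB addrC subrK.
have Ed : f d c a = f d a b + (x + y).
  rewrite -[x + y]opprK -zE -(angle_sym pa'') -(f_angle pd) (corner_sym pd).
  by rewrite opprB addrC subrK.
have Ed' : f d b c = f d a b - (x + s).
  by rewrite -uE -(angle_sym pb') -(f_angle pd'') (corner_sym pd'') addrC subrK.
rewrite /face_wedge Ea Ea' Eb Eb' Ec Ec' Ed Ed' -(corner_sym p).
by rewrite zE wedgeNl wedgeNr opprK; exact: wedge_tetrahedron.
Qed.

Variables (va vb vc vd : {set V} -> V).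
Hypothesis hv : forall t, t \in simplices K 3 ->
  t = vset (va t) (vb t) (vc t) (vd t) /\ pos (va t) (vb t) (vc t) (vd t).

(** The face opposite to x carries the boundary orientation: it is listed so
    that x followed by its vertices is an even permutation of the chosen order
    of the vertices of t. *)
Definition opposite_face_wedge t x : ext_square A :=
  if x == va t then face_wedge (vb t) (vc t) (vd t)
  else if x == vb t then face_wedge (va t) (vd t) (vc t)
  else if x == vc t then face_wedge (vd t) (va t) (vb t)
  else face_wedge (vc t) (vb t) (va t).

Lemma opposite_face_wedgeE a b c d : pos a b c d ->
  opposite_face_wedge (vset a b c d) a = face_wedge b c d.
Proof.
move=> p; have [E q] := hv (pos_simplex hpos p).
rewrite /opposite_face_wedge; set t := vset a b c d in E q *.
move: (va t) (vb t) (vc t) (vd t) E q => a' b' c' d' E q.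
have unique x y z : pos a x y z -> vset a x y z = t ->
    face_wedge x y z = face_wedge b c d.
  move=> p' E'; have [[-> -> ->]|[-> -> ->]|[-> -> ->]] :=
    pos_rotation_unique hpos p p' E' => //; last by rewrite -face_wedge_rot.
  exact: face_wedge_rot.
have q2 := pos_flip hpos q.
have q3 := pos_rot hpos (pos_rot hpos (pos_cycle hpos (pos_cycle hpos q))).
have q4 := pos_flip hpos q3.
have : a \in vset a' b' c' d' by rewrite -E !inE eqxx.
rewrite !inE -!orbA.
have [aa'|_] := eqVneq a a'; first by move=> _; apply: unique; rewrite ?E aa'.
have [ab'|_] := eqVneq a b'.
  by move=> _; apply: unique; rewrite ?E ab'// vset_swap12 vset_swap34.
have [ac'|_] := eqVneq a c'.
  move=> _; apply: unique; rewrite ?E ac'//; apply/setP => x; rewrite !inE.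
  by do 4 case: (x == _).
move=> /= /eqP ad'; apply: unique; rewrite ?E ad'//; apply/setP => x.
by rewrite !inE; do 4 case: (x == _).
Qed.

Lemma sum_opposite_faces t : t \in simplices K 3 ->
  \sum_(x in t) opposite_face_wedge t x =
  face_wedge (vb t) (vc t) (vd t) + face_wedge (va t) (vd t) (vc t)
  + face_wedge (vd t) (va t) (vb t) + face_wedge (vc t) (vb t) (va t).
Proof.
move=> tT; have [E p] := hv tT; have vat : va t \in t.
  have : va t \in vset (va t) (vb t) (vc t) (vd t) by rewrite !inE eqxx.
  by rewrite -E.
rewrite (bigD1 (va t)) //=.
have -> : \sum_(x in t | x != va t) opposite_face_wedge t x =
    \sum_(x in vset (va t) (vb t) (vc t) (vd t) | x != va t)
       opposite_face_wedge t x.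
  by rewrite -E.
have [[ab ac ad] [bc bd] cd] := pos_neq hpos p.
rewrite (sum_link hpos _ p) /opposite_face_wedge eqxx.
rewrite [vb t == _]eq_sym [vc t == va t]eq_sym [vd t == va t]eq_sym.
rewrite (negbTE ab) (negbTE ac) (negbTE ad) eqxx.
rewrite [vc t == _]eq_sym [vd t == _]eq_sym.
rewrite (negbTE bc) (negbTE bd) eqxx [vd t == _]eq_sym (negbTE cd).
exact: (AC (1*3) (1*2*3*4)).
Qed.

(** If a tetrahedron xbcd contains the face F = bcd, then the cyclic star of the
    edge bc continues past the face to a second tetrahedron ebcd, and
    [pos_coherent] excludes a third. The two induce opposite orientations. *)
Lemma sum_opposite_cancel (F : {set V}) :
  \sum_(x | (x \notin F) && (x |: F \in simplices K 3)%SET)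
     opposite_face_wedge (x |: F)%SET x = 0.
Proof.
have [[x /andP[xF xFT]]|no] := pselect (exists x, (x \notin F) &&
    (x |: F \in simplices K 3)%SET); last first.
  by rewrite big1 // => x xF; case: no; exists x.
have [E q] := hv xFT.
have [|b [c [d [p Et]]]] := @pos_from V K pos hpos _ _ _ _ x q.
  by rewrite -E !inE eqxx.
have [[xb xc xd] [bc bd] cd] := pos_neq hpos p.
have EF : F = [set b; c; d]%SET.
  rewrite -(setU1K xF) E -Et vsetE setU1K// !inE.
  by rewrite (negbTE xb) (negbTE xc) (negbTE xd).
have [e pe] : exists e, pos b c d e.
  have r := pos_cycle hpos p.
  have [s [_ sP] _] := hangled bc (pos_edge r).
  move: r; rewrite sP => /andP[xs /eqP Ed]; exists (next s d).
  by rewrite sP eqxx andbT Ed mem_next.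
have p' := pos_cycle hpos (pos_cycle hpos (pos_flip hpos pe)).
have xe : e != x.
  apply/negP => /eqP ex; move: p'.
  by rewrite ex (pos_swap23 hpos (pos_simplex hpos p)) p.
have two y : (y \notin F) && (y |: F \in simplices K 3)%SET
    = (y == x) || (y == e).
  apply/andP/orP => [[yF]|[]/eqP ->]; last 2 first.
  - by rewrite xF xFT.
  - have [[ec eb ed] _ _] := pos_neq hpos p'.
    rewrite EF -vsetE -vset_swap23 (pos_simplex hpos p') !inE.
    by rewrite (negbTE ec) (negbTE eb) (negbTE ed).
  rewrite EF -vsetE => /(vset_pos hpos)/orP[] py.
    by left; apply/eqP; exact: (pos_coherent hpos p py).
  by right; apply/eqP; exact: (pos_coherent hpos p' py).
rewrite (eq_bigl _ _ two) (bigD1 x) ?eqxx//= (big_pred1 e) => [|y]; last first.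
  by have [->|_] := eqVneq y x; rewrite /= ?andbT// [x == e]eq_sym (negbTE xe).
rewrite EF -!vsetE (opposite_face_wedgeE p) -vset_swap23.
by rewrite (opposite_face_wedgeE p') (face_wedge_swap pe) subrr.
Qed.

Lemma sum_face_exchange (G : {set V} -> V -> ext_square A) :
  \sum_(t in simplices K 3) \sum_(x in t) G t x =
  \sum_(F : {set V}) \sum_(x | (x \notin F) && (x |: F \in simplices K 3)%SET)
     G (x |: F)%SET x.
Proof.
rewrite (exchange_big_dep xpredT)//= [RHS](exchange_big_dep xpredT)//=.
apply: eq_bigr => x _.
rewrite (reindex_onto (fun F : {set V} => x |: F)%SET
  (fun t : {set V} => t :\ x)%SET).
  apply: eq_bigl => F; rewrite inE [x \in _]inE set11 orTb andbT andbC.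
  congr (_ && _); apply/eqP/idP => [<-|xF]; first by rewrite !inE eqxx.
  exact: setU1K.
by move=> t /andP[_ xt]; exact: finset.setD1K.
Qed.
Lemma wedge_angle_sum :
  \sum_(t in simplices K 3)
    (let a := va t in let b := vb t in let c := vc t in let d := vd t in
     wedge (angle k a b c d) (angle k a c d b) *+ 4
     + wedge (angle k a d b c) (angle k a d b c)
     + wedge (angle k b c a d) (angle k b c a d)) = 0.
Proof.
transitivity (\sum_(t in simplices K 3) \sum_(x in t) opposite_face_wedge t x).
  apply: eq_bigr => t tT; rewrite sum_opposite_faces//.
  exact: tetrahedron_faces (hv tT).2.
by rewrite sum_face_exchange big1 // => F _; exact: sum_opposite_cancel.
Qed.

End Corners.

End Angles.

Theorem theorem3 (R : realType) (A : zmodType) (V : finType)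
    (K : {set {set V}}) (pos : V -> V -> V -> V -> bool)
    (k : {set V} -> V -> V -> A) (va vb vc vd : {set V} -> V)
    (hX : closed_triangulated_3manifold R K)
    (hpos : orientation K pos)
    (hk : forall t, t \in simplices K 3 -> angle_structure t (k t))
    (hangled : angled K pos k)
    (hv : forall t, t \in simplices K 3 ->
            t = vset (va t) (vb t) (vc t) (vd t)
            /\ pos (va t) (vb t) (vc t) (vd t)) :
  \sum_(t in simplices K 3)
    (let a := va t in let b := vb t in let c := vc t in let d := vd t in
     wedge (angle k a b c d) (angle k a c d b) *+ 4
     + wedge (angle k a d b c) (angle k a d b c)
     + wedge (angle k b c a d) (angle k b c a d)) = 0.
Proof.
have [K_complex _ manif] := hX.
have [f [f_angle f_sym]] := corner_potential K_complex hpos hk hangled manif.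
exact: (wedge_angle_sum K_complex hpos hk hangled f_angle f_sym hv).
Qed.
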